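(* Let $\mathfrak h$ be a nonnegative sesquilinear form in a complex Hilbert space $\mathfrak H$ with the representation $\mathfrak h[\varphi,\psi]=(Q\varphi,Q\psi)_{\mathfrak K}$, $\varphi,\psi\in\operatorname{dom}\mathfrak h=\operatorname{dom}Q$, where $Q$ is a linear operator from $\mathfrak H$ to a Hilbert space $\mathfrak K$ which is minimal, i.e. $\overline{\operatorname{ran}}\,Q=\mathfrak K$. Let $K\in\mathbf B(\mathfrak K)$ be a nonnegative contraction, let $\mathfrak K_1=\overline{\operatorname{ran}}(I-K)$ and $\mathfrak K_2=\overline{\operatorname{ran}}\,K$ (each with the inner product of $\mathfrak K$), and assume that with respect to $K$ the form $\mathfrak h$ has the representation $$\mathfrak h[\varphi,\psi]=\left(\begin{pmatrix}(I-K)^{1/2} \\ {K^{1/2}}\end{pmatrix}Q\varphi,\begin{pmatrix}(I-K)^{1/2} \\ {K^{1/2}}\end{pmatrix}Q\psi\right)_{\mathfrak K_1\oplus\mathfrak K_2},\qquad\varphi,\psi\in\operatorname{dom}\mathfrak h=\operatorname{dom}Q.\qquad( * )$$ Then $(I-K)^{1/2}Q$ is an operator from $\mathfrak H$ into $\mathfrak K_1$ with dense range and $K^{1/2}Q$ is an operator from $\mathfrak H$ into $\mathfrak K_2$ with dense range. Moreover, the following statements are equivalent: (i) the representation $( * )$ is minimal; (ii) $K$ is an orthogonal projection.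
   Context: A (sesquilinear) form $\mathfrak h$ in $\mathfrak H$ is a map $\operatorname{dom}\mathfrak h\times\operatorname{dom}\mathfrak h\to\mathbb C$, linear in the first and antilinear in the second entry, where $\operatorname{dom}\mathfrak h$ is a (not necessarily dense) linear subspace of $\mathfrak H$. It is nonnegative if $\mathfrak h[\varphi,\varphi]\ge0$ on $\operatorname{dom}\mathfrak h$. A nonnegative contraction is a bounded everywhere defined selfadjoint operator $K$ on $\mathfrak K$ with $0\le K\le I$. $\overline{\operatorname{ran}}$ denotes the closure of the range. For operators $Q_1,Q_2$ with common domain, the column $\begin{pmatrix}Q_1 \\ {Q_2}\end{pmatrix}$ maps $\varphi$ to $(Q_1\varphi,Q_2\varphi)$ in the orthogonal sum. The representation $( * )$ is called minimal if the representing map $\varphi\mapsto((I-K)^{1/2}Q\varphi,K^{1/2}Q\varphi)$, $\varphi\in\operatorname{dom}Q$, has dense range in $\mathfrak K_1\oplus\mathfrak K_2$. *)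

(* Defs.v *)
From HB Require Import structures.
From mathcomp Require Import all_boot all_order all_algebra.
From mathcomp Require Import sesquilinear complex.
From mathcomp Require Import all_classical all_reals all_analysis.

Set Implicit Arguments.
Unset Strict Implicit.
Unset Printing Implicit Defensive.

Import Order.TTheory GRing.Theory Num.Theory numFieldNormedType.Exports.

Local Open Scope classical_set_scope.
Local Open Scope complex_scope.
Local Open Scope ring_scope.

(* The order on R[i] is the partial one: 0 <= z says that z is real and
   nonnegative.  The norm of a normedModType over R[i] is R[i]-valued.  The
   inner product is linear in its first and antilinear in its second entry. *)
HB.mixin Record isHilbert (R : realType) H of CompleteNormedModule R[i] H := {
  inner : {dot H for (@Num.conj R[i])} ;
  inner_norm : forall x : H, `|x| ^+ 2 = inner x x
}.

#[short(type="hilbertType")]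
HB.structure Definition Hilbert (R : realType) :=
  {H of isHilbert R H & CompleteNormedModule R[i] H}.

Definition linear_subspace (C : pzRingType) (V : lmodType C) (D : set V) :=
  D 0 /\ forall (a : C) u v, D u -> D v -> D (a *: u + v).

(* Sesquilinear forms and operators need not be everywhere defined; the values
   of the underlying total functions outside the domain are irrelevant. *)
Record partial_form (C : Type) (V : Type) := PartialForm {
  fdom : set V ;
  fval :> V -> V -> C }.

Record partial_map (V W : Type) := PartialMap {
  dom : set V ;
  pval :> V -> W }.

Definition sesquilinear_form (C : numClosedFieldType) (V : lmodType C)
    (h : partial_form C V) :=
  [/\ linear_subspace (fdom h),
      forall (a : C) u v w, fdom h u -> fdom h v -> fdom h w ->
        h (a *: u + v) w = a * h u w + h v w
    & forall (a : C) u v w, fdom h u -> fdom h v -> fdom h w ->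
        h w (a *: u + v) = a^* * h w u + h w v].

Definition nonneg_form (C : numClosedFieldType) (V : lmodType C)
    (h : partial_form C V) :=
  forall u, fdom h u -> 0 <= h u u.

Definition operator (C : pzRingType) (V W : lmodType C)
    (T : partial_map V W) :=
  linear_subspace (dom T) /\
  forall (a : C) u v, dom T u -> dom T v -> T (a *: u + v) = a *: T u + T v.

Definition ran (V W : Type) (T : partial_map V W) : set W := T @` dom T.

Definition op_comp (V W X : Type) (S : W -> X) (T : partial_map V W) :
    partial_map V X :=
  PartialMap (dom T) (S \o T).

Definition column (V W X : Type) (Q1 : partial_map V W) (Q2 : partial_map V X) :
    partial_map V (W * X) :=
  PartialMap (dom Q1 `&` dom Q2) (fun u => (Q1 u, Q2 u)).

Definition represents (C V W : Type) (h : partial_form C V)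
    (ip : W -> W -> C) (T : partial_map V W) :=
  fdom h = dom T /\
  forall u v, fdom h u -> fdom h v -> h u v = ip (T u) (T v).

Definition into_with_dense_range (V : Type) (W : topologicalType)
    (T : partial_map V W) (L : set W) :=
  ran T `<=` L /\ L `<=` closure (ran T).

Section HilbertOperators.
Variable R : realType.
Implicit Types K L : hilbertType R.

(* The inner product of the orthogonal sum.  The library's norm on K * L is the
   max norm; its topology, used for closures in K * L, is the product topology
   and hence coincides with that of the norm of this inner product. *)
Definition osum_inner K L (x y : K * L) : R[i] :=
  inner x.1 y.1 + inner x.2 y.2.

Definition bounded_operator K (A : K -> K) :=
  linear A /\ exists M : R, forall x, `|A x| <= M%:C * `|x|.

Definition selfadjoint K (A : K -> K) :=
  forall x y, inner (A x) y = inner x (A y).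

Definition op_le K (A B : K -> K) :=
  forall x, inner (A x) x <= inner (B x) x.

Definition nonneg_contraction K (A : K -> K) :=
  [/\ bounded_operator A, selfadjoint A,
      op_le (fun=> 0) A & op_le A idfun].

Definition orthogonal_projection K (P : K -> K) :=
  [/\ bounded_operator P, selfadjoint P & P \o P = P].

(* The square root of a nonnegative bounded selfadjoint A is the unique
   nonnegative bounded selfadjoint S with S ^ 2 = A; [get] selects it, and
   yields an unspecified function when there is no such S. *)
Definition is_nonneg_sqrt K (A S : K -> K) :=
  [/\ bounded_operator S, selfadjoint S, op_le (fun=> 0) S & S \o S = A].

Definition op_sqrt K (A : K -> K) : K -> K := get (is_nonneg_sqrt A).

End HilbertOperators.

(* Main.v *)
(** Write [S] and [T] for the square roots of [I - K] and [K].  The range of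
    [S] is dense in the closure of the range of [S^2], and a nonexpansive map
    sends the dense range of [Q] to a dense subset of its range; this gives the
    density of [S Q] and [T Q].  As [K = T^2 = I - S^2] commutes with [S] and
    [T], the vector [(S K z, - T (I - K) z)] of [K1 * K2] is orthogonal to all
    [(S q, T q)], so minimality forces [S K z = 0], hence [(I - K) K = 0].
    Conversely, if [K^2 = K] then [S T] vanishes on [K2] and [T S] on [K1], so
    [q = S x + T y] is sent to [(x, y)].  Uniqueness of square roots plays no
    role; [sqrt A = I - Z] is obtained by solving [Z = (B + Z^2) / 2], where
    [B = I - A], by iteration. *)
Require Import Defs.
From mathcomp Require Import all_boot all_order all_algebra.
From mathcomp Require Import sesquilinear complex ring lra.
From mathcomp Require Import all_classical all_reals all_analysis.

Set Implicit Arguments.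
Unset Strict Implicit.
Unset Printing Implicit Defensive.

Import Order.TTheory GRing.Theory Num.Theory numFieldNormedType.Exports.

Local Open Scope classical_set_scope.
Local Open Scope complex_scope.
Local Open Scope ring_scope.

(** * Real parts of the inner product and of the norm *)

Section RealPart.
Variable R : rcfType.
Implicit Types z w : R[i].

Lemma ReD z w : complex.Re (z + w) = complex.Re z + complex.Re w.
Proof. by case: z; case: w. Qed.

Lemma ReN z : complex.Re (- z) = - complex.Re z.
Proof. by case: z. Qed.

Lemma ReZ (a : R) z : complex.Re (a%:C * z) = a * complex.Re z.
Proof. by case: z => ? ? /=; rewrite mul0r subr0. Qed.
End RealPart.

Section RealStructure.
Variables (R : realType) (H : hilbertType R).
Implicit Types x y z : H.

(** Working with values in [R] gives a total order, where [lra] and [nra] apply, instead of the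
    partial order of [R[i]]. *)
Definition rdot x y : R := complex.Re (inner x y).
Definition rnorm x : R := complex.Re `|x|.

Lemma innerC x y : inner x y = (inner y x)^*%C.
Proof. by rewrite (hermC (inner : {dot H for _})) expr0 mul1r. Qed.

Lemma rdotC x y : rdot x y = rdot y x.
Proof. by rewrite /rdot innerC; case: (inner y x). Qed.

Lemma rdotDl x y z : rdot (x + y) z = rdot x z + rdot y z.
Proof. by rewrite /rdot linearDl; apply: ReD. Qed.

Lemma rdotNl x y : rdot (- x) y = - rdot x y.
Proof. by rewrite /rdot linearNl; apply: ReN. Qed.

Lemma rdotZl (a : R) x y : rdot (a%:C *: x) y = a * rdot x y.
Proof.
by rewrite /rdot linearZl_LR; apply: ReZ.
Qed.

Lemma rdotDr x y z : rdot z (x + y) = rdot z x + rdot z y.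
Proof. by rewrite rdotC rdotDl !(rdotC z). Qed.

Lemma rdotNr x y : rdot y (- x) = - rdot y x.
Proof. by rewrite rdotC rdotNl (rdotC y). Qed.

Lemma rdotZr (a : R) x y : rdot y (a%:C *: x) = a * rdot y x.
Proof. by rewrite rdotC rdotZl (rdotC y). Qed.

Definition rdotE := (rdotDl, rdotDr, rdotNl, rdotNr, rdotZl, rdotZr).

Lemma normE x : `|x| = (rnorm x)%:C.
Proof.
by rewrite /rnorm RRe_real // realE normr_ge0.
Qed.

Lemma rnorm_ge0 x : 0 <= rnorm x.
Proof. by rewrite -ler0c -normE. Qed.

Lemma rnorm_sqr x : rnorm x ^+ 2 = rdot x x.
Proof. by rewrite /rdot -inner_norm normE -rmorphXn. Qed.

Lemma innerxx x : inner x x = (rdot x x)%:C.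
Proof. by rewrite -inner_norm normE -rmorphXn rnorm_sqr. Qed.

Lemma rdot_ge0 x : 0 <= rdot x x.
Proof. by rewrite -rnorm_sqr sqr_ge0. Qed.

Lemma rnormD x y : rnorm (x + y) <= rnorm x + rnorm y.
Proof. by rewrite -lecR rmorphD/= -!normE ler_normD. Qed.

Lemma rnormN x : rnorm (- x) = rnorm x.
Proof. by rewrite /rnorm normrN. Qed.

Lemma rnormZ (a : R[i]) x : rnorm (a *: x) = complex.Re `|a| * rnorm x.
Proof.
apply: complexI; rewrite (rmorphM (real_complex R)) -!normE normrZ normE.
by congr (_ * _); apply/esym/RRe_real; rewrite realE normr_ge0.
Qed.

Lemma rnormZr (a : R) x : 0 <= a -> rnorm (a%:C *: x) = a * rnorm x.
Proof. by move=> a0; rewrite rnormZ ger0_norm // ler0c. Qed.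

Lemma rnorm0 : rnorm 0 = 0.
Proof. by rewrite /rnorm normr0. Qed.

Lemma rnorm_eq0 x : rnorm x <= 0 -> x = 0.
Proof.
move=> h; apply/eqP; rewrite -normr_eq0 normE.
by have -> : rnorm x = 0 by apply/eqP; rewrite eq_le h rnorm_ge0.
Qed.

Lemma rnorm_le_sqr x y : rdot x x <= rdot y y -> rnorm x <= rnorm y.
Proof. by rewrite -!rnorm_sqr ler_sqr ?nnegrE ?rnorm_ge0. Qed.

(** Cauchy-Schwarz, read off by squaring the triangle inequality, which the normed structure already
    provides. *)
Lemma rdot_le x y : rdot x y <= rnorm x * rnorm y.
Proof.
have [x0 y0] := (rnorm_ge0 x, rnorm_ge0 y).
have h : rnorm (x + y) ^+ 2 <= (rnorm x + rnorm y) ^+ 2.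
  by rewrite ler_sqr ?nnegrE ?rnorm_ge0 ?addr_ge0 ?rnormD.
by move: h; rewrite sqrrD !rnorm_sqr !rdotE (rdotC y x) -mulr_natl; lra.
Qed.

End RealStructure.

(** * Closures and limits in terms of the real norm *)

Section Topology.
Variable R : realType.
Implicit Types H L : hilbertType R.

Lemma gt0_real_complex (e : R[i]) : 0 < e -> exists2 d : R, 0 < d & e = d%:C.
Proof.
move=> e0; exists (complex.Re e); last by rewrite RRe_real // gtr0_real.
by rewrite -ltcR RRe_real // gtr0_real.
Qed.

Lemma ball_rnorm H (x y : H) (e : R) : ball x e%:C y <-> rnorm (x - y) < e.
Proof. by rewrite -ball_normE /ball_/= normE ltcR. Qed.

Lemma rnorm_closureP H (A : set H) x :
  closure A x <-> forall e, 0 < e -> exists2 a, A a & rnorm (x - a) < e.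
Proof.
rewrite closureEnbhs; split => [h e e0|h].
  have [a [Aa /ball_rnorm xa]] : A `&` ball x e%:C !=set0.
    by apply: h => //; apply: nbhsx_ballx; rewrite ltcR.
  by exists a.
move=> U V AU /nbhs_ballP[_ /= /gt0_real_complex[d d0 ->] xV].
have [a Aa xa] := h _ d0; exists a; split; first exact: AU.
by apply: xV; apply/ball_rnorm.
Qed.

Lemma rnorm_prod_closureP H L (A : set (H * L)) (p : H * L) :
  closure A p <-> forall e, 0 < e ->
    exists2 a, A a & rnorm (p.1 - a.1) < e /\ rnorm (p.2 - a.2) < e.
Proof.
rewrite closureEnbhs; split => [h e e0|h].
  have [a [Aa [/= /ball_rnorm xa /ball_rnorm ya]]] : A `&` ball p e%:C !=set0.
    by apply: h => //; apply: nbhsx_ballx; rewrite ltcR.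
  by exists a.
move=> U V AU /nbhs_ballP[_ /= /gt0_real_complex[d d0 ->] xV].
have [a Aa [xa ya]] := h _ d0; exists a; split; first exact: AU.
by apply: xV; split; apply/ball_rnorm.
Qed.

Lemma ler_addgt0 (a b : R) : (forall e, 0 < e -> a <= b + e) -> a <= b.
Proof. by move=> h; apply/ler_addgt0Pr. Qed.

(** An explicit Cauchy rate survives in the limit: [u n] and [l] are both compared with a term whose
    index is at least [n] and large enough to be near [l]. *)
Lemma rnorm_complete H (u : nat -> H) (r : nat -> R) :
  (forall m n, (m <= n)%N -> rnorm (u n - u m) <= r m) ->
  (forall e, 0 < e -> exists n, r n < e) ->
  exists l, forall n, rnorm (u n - l) <= r n.
Proof.
move=> ur r0.
have /cauchy_cvgP/cvg_ex[l /cvgrPdist_lt ul] : cauchy (u @ \oo).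
  apply: cauchy_exP => _ /gt0_real_complex[e e0 ->].
  have [n rn] := r0 _ e0; exists (u n); exists n => // m /= nm.
  by apply/ball_rnorm; rewrite -opprB rnormN (le_lt_trans (ur _ _ nm)).
exists l => n; apply: ler_addgt0 => e e0.
have [N _ uN] : \forall m \near \oo, `|l - u m| < e%:C.
  by apply: ul; rewrite ltcR.
have := uN (maxn N n) (leq_maxl _ _); rewrite normE ltcR => lm.
have -> : u n - l = - (u (maxn N n) - u n) - (l - u (maxn N n)).
  by rewrite !opprB addrA subrK.
apply: le_trans (rnormD _ _) _; rewrite !rnormN lerD ?ur ?leq_maxr//.
exact: ltW.
Qed.

(** If every decrement were at least [e], then [a n <= a 0 - n * e], which is negative once [n]
    exceeds [a 0 / e]. *)
Lemma small_decrement (a : nat -> R) : (forall n, 0 <= a n) ->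
  forall e, 0 < e -> exists n, a n - a n.+1 < e.
Proof.
move=> a0 e e0; apply/not_existsP => h.
have {}h n : a n <= a 0 - n%:R * e.
  elim: n => [|n ih]; first by rewrite mul0r subr0.
  have /negP := h n; rewrite -leNgt -natr1; lra.
have := h (Num.truncn (a 0 / e)).+1; apply/negP; rewrite -ltNge.
have : a 0 / e < (Num.truncn (a 0 / e)).+1%:R by apply: truncnS_gt.
rewrite ltr_pdivrMr // => lt; apply: lt_le_trans (a0 _); lra.
Qed.

End Topology.

(** * Nonnegative contractions and their elementary inequalities *)

Section Contractions.
Variables (R : realType) (H : hilbertType R).
Implicit Types (x y z u v : H) (A S : H -> H).

(** Turns identities between vectors into identities in [R], within reach of [field] and [lra]. *)
Lemma rdot_ext x y : (forall z, rdot x z = rdot y z) -> x = y.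
Proof.
move=> h; apply/subr0_eq/rnorm_eq0.
have : rnorm (x - y) ^+ 2 = 0 by rewrite rnorm_sqr rdotDl rdotNl h subrr.
by move/eqP; rewrite expf_eq0/= => /eqP ->.
Qed.

Lemma linear_fun0 A : linear A -> A 0 = 0.
Proof.
by move=> lA; have := lA (-1) 0 0; rewrite scaler0 addr0 scaleN1r addNr.
Qed.

Lemma linear_funD A : linear A -> {morph A : x y / x + y}.
Proof. by move=> lA x y; rewrite -[x in LHS]scale1r lA scale1r. Qed.

Lemma linear_funZ A a : linear A -> {morph A : x / a *: x}.
Proof. by move=> lA x; rewrite -[_ *: x]addr0 lA linear_fun0 // addr0. Qed.

Lemma linear_funN A : linear A -> {morph A : x / - x}.
Proof. by move=> lA x; rewrite -scaleN1r linear_funZ // scaleN1r. Qed.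

Lemma linear_funB A : linear A -> {morph A : x y / x - y}.
Proof. by move=> lA x y; rewrite linear_funD // linear_funN. Qed.

Definition rselfadjoint A := forall x y, rdot (A x) y = rdot x (A y).

Lemma rdotZil x y : rdot ('i%C *: x) y = - complex.Im (inner x y).
Proof. by rewrite /rdot linearZl_LR mulrC; apply: ReiNIm. Qed.

(** The imaginary part of [inner x y] is minus the real part of [inner ('i *: x) y], so real
    symmetry at ['i *: x] yields equality of the imaginary parts. *)
Lemma rselfadjointP A : linear A -> rselfadjoint A <-> selfadjoint A.
Proof.
move=> lA; split=> h x y; last by rewrite /rdot h.
apply/eqP; rewrite eq_complex; apply/andP; split; apply/eqP; first exact: h.
by apply: oppr_inj; rewrite -!rdotZil -h linear_funZ.
Qed.

Lemma selfadjoint_inner A x :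
  selfadjoint A -> inner (A x) x = (rdot (A x) x)%:C.
Proof.
move=> sA; rewrite /rdot.
have : inner (A x) x = (inner (A x) x)^*%C by rewrite -innerC sA.
case: (inner (A x) x) => a b [] /eqP.
by rewrite -addr_eq0 -mulr2n mulrn_eq0/= => /eqP ->.
Qed.

(** The real counterpart of [nonneg_contraction]; the norm bound 1 is recovered in
    [rcontraction_nexp]. *)
Definition rcontraction A :=
  [/\ linear A, rselfadjoint A, forall x, 0 <= rdot (A x) x
    & forall x, rdot (A x) x <= rdot x x].

Lemma nonneg_contraction_re A : nonneg_contraction A -> rcontraction A.
Proof.
move=> [[lA _] sA A0 A1]; split => //; first exact/rselfadjointP.
  by move=> x; have := A0 x; rewrite linear0l selfadjoint_inner// ler0c.
by move=> x; have := A1 x; rewrite /= selfadjoint_inner// innerxx lecR.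
Qed.

Lemma rcontraction_compl A : rcontraction A -> rcontraction (idfun \- A).
Proof.
move=> [lA sA A0 A1]; split => [a x y|x y|x|x] /=.
- by rewrite lA scalerBr addrACA opprD.
- by rewrite !rdotE sA.
- by rewrite !rdotE subr_ge0.
- by rewrite !rdotE gerBl.
Qed.

Lemma rcontraction_firm A x :
  rcontraction A -> rdot (A x) (A x) <= rdot (A x) x.
Proof.
move=> cA; have [lA sA A0 A1] := cA.
(* [A - A^2 = A (I - A) A + (I - A) A (I - A)] *)
have := A1 (A x); have := A0 (x - A x).
by rewrite linear_funB // !rdotE (sA (A x) x); lra.
Qed.

Lemma rcontraction_nexp A x : rcontraction A -> rnorm (A x) <= rnorm x.
Proof.
move=> cA; have [_ _ _ A1] := cA.
by apply: rnorm_le_sqr; apply: le_trans (A1 x); apply: rcontraction_firm.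
Qed.

(** The bound [S <= I] comes from expanding [0 <= |x - S x|^2 = |x|^2 - 2 (S x, x) + (A x, x)] and
    using [A <= I]. *)
Lemma is_nonneg_sqrt_rcontraction A S :
  rcontraction A -> is_nonneg_sqrt A S -> rcontraction S.
Proof.
move=> [_ _ _ A1] [[lS _] sS S0 SS].
have rS : rselfadjoint S by apply/rselfadjointP.
split => // x.
  by have := S0 x; rewrite linear0l selfadjoint_inner// ler0c.
have := rdot_ge0 (x - S x); have := A1 x.
rewrite -SS /= rS !rdotE (rdotC x (S x)); lra.
Qed.

End Contractions.

(** * The fixed point of Z = (B + Z^2) / 2 *)

Section SquareRoot.
Variables (R : realType) (H : hilbertType R) (B : H -> H).
Hypothesis cB : rcontraction B.
Implicit Types x y z u v : H.

Local Notation half := ((2^-1 : R)%:C).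

Fixpoint sqrt_iter n : H -> H :=
  if n is m.+1 then fun x => half *: (B x + sqrt_iter m (sqrt_iter m x))
  else fun=> 0.

(* [1 - sqrt_gap n] is the scalar iteration with [B = 1]; it dominates
   [sqrt_iter n] and tends to [1]. *)
Fixpoint sqrt_gap n : R :=
  if n is m.+1 then sqrt_gap m - sqrt_gap m ^+ 2 / 2 else 1.

Local Notation Y := sqrt_iter.
Local Notation r := sqrt_gap.

Lemma sqrt_iterS n x : Y n.+1 x = half *: (B x + Y n (Y n x)).
Proof. by []. Qed.

Lemma sqrt_gap01 n : 0 <= r n <= 1.
Proof. by elim: n => [|n /andP[? ?]] /=; rewrite ?ler01 ?lexx//; nra. Qed.

Lemma sqrt_gapS n : r n.+1 <= r n.
Proof. by rewrite /= gerBl divr_ge0 ?sqr_ge0. Qed.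

(** The decrement [r n - r n.+1] equals [r n ^+ 2 / 2], so a decrement below [e ^+ 2 / 2] forces
    [r n < e]. *)
Lemma sqrt_gap_small e : 0 < e -> exists n, r n < e.
Proof.
move=> e0; have r0 n : 0 <= r n by case/andP: (sqrt_gap01 n).
have [|n] := @small_decrement _ r r0 (e ^+ 2 / 2).
  by rewrite divr_gt0// exprn_gt0.
rewrite /= opprB addrCA subrr addr0 ltr_pM2r ?invr_gt0// => h.
by exists n; move: h; rewrite ltr_sqr ?nnegrE// ltW.
Qed.

Lemma sqrt_iter_linear n : linear (Y n).
Proof.
have [lB _ _ _] := cB; elim: n => [|n ih] a x y /=.
  by rewrite scaler0 addr0.
rewrite !ih lB scalerA (mulrC a) -scalerA -scalerDr; congr (_ *: _).
by rewrite scalerDr addrACA.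
Qed.

Lemma sqrt_iter_rselfadjoint n : rselfadjoint (Y n).
Proof.
have [_ sB _ _] := cB; elim: n => [|n ih] x y /=.
  by rewrite -(scale0r x) -[0 : R[i]]/(0%:C) scale0r -(scale0r y) !rdotE !mul0r.
by rewrite !rdotE sB !ih.
Qed.

(** The induction closes because [(1 + (1 - r n) ^+ 2) / 2 = 1 - r n.+1]. *)
Lemma sqrt_iter_bound n x : rnorm (Y n x) <= (1 - r n) * rnorm x.
Proof.
elim: n x => [|n ih] x /=; first by rewrite rnorm0 subrr mul0r.
rewrite rnormZr ?invr_ge0//.
have h := rnormD (B x) (Y n (Y n x)).
have hB := rcontraction_nexp x cB.
have h1 := ih (Y n x); have h2 := ih x.
have /andP[r0 r1] := sqrt_gap01 n; have x0 := rnorm_ge0 x.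
have : (1 - r n) * rnorm (Y n x) <= (1 - r n) * ((1 - r n) * rnorm x).
  by rewrite ler_wpM2l// subr_ge0.
nra.
Qed.

Lemma sqrt_iter_nexp n x : rnorm (Y n x) <= rnorm x.
Proof.
apply: le_trans (sqrt_iter_bound n x) _.
have /andP[r0 r1] := sqrt_gap01 n; have x0 := rnorm_ge0 x; nra.
Qed.

(** With D the difference of [Y n.+1] and [Y n], the next difference is [(Y n.+1 D + D Y n) / 2].
    Bounding each factor gives [((1 - r n.+1) + (1 - r n)) (r n - r n.+1) / 2], which is exactly
    [r n.+1 - r n.+2]. *)
Lemma sqrt_iter_step n x :
  rnorm (Y n.+1 x - Y n x) <= (r n - r n.+1) * rnorm x.
Proof.
elim: n x => [|n ih] x.
  rewrite /= subr0 rnormZr ?invr_ge0// addr0.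
  have := rcontraction_nexp x cB; lra.
have lY := sqrt_iter_linear.
have -> : Y n.+2 x - Y n.+1 x =
    half *: (Y n.+1 (Y n.+1 x - Y n x) + (Y n.+1 (Y n x) - Y n (Y n x))).
  rewrite [LHS](congr2 (fun u v => u - v) (sqrt_iterS n.+1 x) (sqrt_iterS n x)).
  rewrite (linear_funB (lY n.+1)) -scalerBr; congr (_ *: _).
  by rewrite opprD addrACA subrr add0r addrA subrK.
rewrite rnormZr ?invr_ge0//.
have h := rnormD (Y n.+1 (Y n.+1 x - Y n x)) (Y n.+1 (Y n x) - Y n (Y n x)).
have h1 := sqrt_iter_bound n.+1 (Y n.+1 x - Y n x).
have h2 := ih (Y n x); have h3 := sqrt_iter_bound n x; have h4 := ih x.
have /andP[r0 r1] := sqrt_gap01 n; have x0 := rnorm_ge0 x.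
have /andP[s0 s1] := sqrt_gap01 n.+1; have rs := sqrt_gapS n.
have k1 : (1 - r n.+1) * rnorm (Y n.+1 x - Y n x) <=
    (1 - r n.+1) * ((r n - r n.+1) * rnorm x) by rewrite ler_wpM2l// subr_ge0.
have k2 : (r n - r n.+1) * rnorm (Y n x) <=
    (r n - r n.+1) * ((1 - r n) * rnorm x) by rewrite ler_wpM2l// subr_ge0.
have -> : r n.+1 - r n.+2 =
    ((1 - r n.+1) * (r n - r n.+1) + (r n - r n.+1) * (1 - r n)) / 2.
  by rewrite /=; field.
lra.
Qed.

Lemma sqrt_iter_cauchy x m n : (m <= n)%N ->
  rnorm (Y n x - Y m x) <= r m * rnorm x.
Proof.
(* The sharper bound with [r m - r n] telescopes, which makes the induction on [n] work. *)
move=> mn; apply: (@le_trans _ _ ((r m - r n) * rnorm x)); last first.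
  have /andP[r0 r1] := sqrt_gap01 n; have x0 := rnorm_ge0 x; nra.
elim: n mn => [|n ih].
  by rewrite leqn0 => /eqP ->; rewrite !subrr rnorm0 mul0r.
rewrite leq_eqVlt => /predU1P[->|]; first by rewrite !subrr rnorm0 mul0r.
rewrite ltnS => /ih {}ih; have := sqrt_iter_step n x.
have := rnormD (Y n.+1 x - Y n x) (Y n x - Y m x).
rewrite addrA subrK; lra.
Qed.

Lemma sqrt_iter_limit : exists Z : H -> H,
  forall x n, rnorm (Y n x - Z x) <= r n * rnorm x.
Proof.
suff /choice[Z YZ] : forall x, exists l,
    forall n, rnorm (Y n x - l) <= r n * rnorm x.
  by exists Z.
move=> x; apply: (@rnorm_complete _ _ (Y ^~ x) (fun n => r n * rnorm x)).
  by move=> m n; apply: sqrt_iter_cauchy.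
move=> e e0; have x0 := rnorm_ge0 x.
have x1 : 0 < rnorm x + 1 by rewrite ltr_wpDl.
(* Adding 1 keeps the denominator positive when [x] is zero. *)
have [|n rn] := @sqrt_gap_small (e / (rnorm x + 1)); first by rewrite divr_gt0.
exists n; move: rn; rewrite ltr_pdivlMr//; apply: le_lt_trans.
have /andP[r0 r1] := sqrt_gap01 n; nra.
Qed.

(** The passage to the limit: each property of the limit [Z] below is reduced to an error of the
    form [r n * C] with [C] independent of [n]. *)
Lemma le0_sqrt_gap (a C : R) : 0 <= C -> (forall n, a <= r n * C) -> a <= 0.
Proof.
move=> C0 h; apply: ler_addgt0 => e e0; rewrite add0r.
have C1 : 0 < C + 1 by rewrite ltr_wpDl.
have [|n rn] := @sqrt_gap_small (e / (C + 1)); first by rewrite divr_gt0.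
have /andP[r0 r1] := sqrt_gap01 n.
move: rn; rewrite ltr_pdivlMr//; have := h n; nra.
Qed.

Lemma sqrt_fixpoint_exists : exists Z : H -> H,
  [/\ linear Z, rselfadjoint Z, forall x, rnorm (Z x) <= rnorm x
    & forall x, 2%:C *: Z x = B x + Z (Z x)].
Proof.
have [Z YZ] := sqrt_iter_limit; exists Z.
have lY := sqrt_iter_linear; have sY := sqrt_iter_rselfadjoint.
have r0 n : 0 <= r n by case/andP: (sqrt_gap01 n).
have nZ x : rnorm (Z x) <= rnorm x.
  rewrite -subr_le0; apply: (@le0_sqrt_gap _ (rnorm x)); first exact: rnorm_ge0.
  move=> n; have := rnormD (- (Y n x - Z x)) (Y n x).
  rewrite opprB subrK -opprB rnormN.
  have := YZ x n; have := sqrt_iter_nexp n x; lra.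
split => //.
- move=> a u v; apply/subr0_eq/rnorm_eq0.
  apply: (@le0_sqrt_gap _ (rnorm (a *: u + v) +
                          (complex.Re `|a| * rnorm u + rnorm v))).
    by rewrite -rnormZ !addr_ge0 ?rnorm_ge0.
  move=> n.
  have -> : Z (a *: u + v) - (a *: Z u + Z v) =
      - (Y n (a *: u + v) - Z (a *: u + v)) +
      (a *: (Y n u - Z u) + (Y n v - Z v)).
    by rewrite lY scalerBr addrACA -opprD opprB addrA subrK.
  have := rnormD (- (Y n (a *: u + v) - Z (a *: u + v)))
                 (a *: (Y n u - Z u) + (Y n v - Z v)).
  have := rnormD (a *: (Y n u - Z u)) (Y n v - Z v).
  have := YZ (a *: u + v) n; have := YZ v n.
  have : rnorm (a *: (Y n u - Z u)) <= complex.Re `|a| * (r n * rnorm u).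
    by rewrite rnormZ ler_wpM2l// -ler0c RRe_real ?normr_ge0 // realE normr_ge0.
  rewrite rnormN; lra.
(* One inequality suffices: exchanging [x] and [y] gives the other. *)
- have half x y : rdot (Z x) y - rdot x (Z y) <= 0.
    apply: (@le0_sqrt_gap _ (2 * (rnorm x * rnorm y))).
      by rewrite !mulr_ge0 ?rnorm_ge0.
    move=> n.
    have -> : rdot (Z x) y - rdot x (Z y) =
        rdot (- (Y n x - Z x)) y + rdot x (Y n y - Z y).
      by rewrite !rdotE sY; ring.
    have := rdot_le (- (Y n x - Z x)) y; have := rdot_le x (Y n y - Z y).
    rewrite rnormN.
    have : rnorm (Y n x - Z x) * rnorm y <= (r n * rnorm x) * rnorm y.
      by rewrite ler_wpM2r ?rnorm_ge0.
    have : rnorm x * rnorm (Y n y - Z y) <= rnorm x * (r n * rnorm y).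
      by rewrite ler_wpM2l ?rnorm_ge0.
    lra.
  move=> x y; apply/eqP; rewrite eq_le -subr_le0 half/= -subr_le0.
  by rewrite (rdotC x) (rdotC (Z x)) half.
- move=> x; apply/subr0_eq/rnorm_eq0.
  apply: (@le0_sqrt_gap _ (3 * rnorm x + rnorm (Z x))).
    by rewrite addr_ge0 ?mulr_ge0 ?rnorm_ge0.
  move=> n.
  (* As [2 Y n.+1 x = B x + Y n (Y n x)] holds exactly, the defect of [Z] splits into three
     approximation errors. *)
  have -> : 2%:C *: Z x - (B x + Z (Z x)) = - (2%:C *: (Y n.+1 x - Z x)) +
      (Y n (Y n x - Z x) + (Y n (Z x) - Z (Z x))).
    rewrite (linear_funB (lY n)); apply: rdot_ext => z.
    by rewrite /= !rdotE; field.
  have := rnormD (- (2%:C *: (Y n.+1 x - Z x)))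
                 (Y n (Y n x - Z x) + (Y n (Z x) - Z (Z x))).
  have := rnormD (Y n (Y n x - Z x)) (Y n (Z x) - Z (Z x)).
  rewrite rnormN rnormZr//.
  have := YZ x n.+1; have := YZ (Z x) n; have := YZ x n.
  have := sqrt_iter_nexp n (Y n x - Z x).
  have : r n.+1 * rnorm x <= r n * rnorm x.
    by rewrite ler_wpM2r ?rnorm_ge0 ?sqrt_gapS.
  lra.
Qed.
End SquareRoot.

(** * Existence of the nonnegative square root *)

Section SqrtExists.
Variables (R : realType) (H : hilbertType R) (A : H -> H).
Hypothesis cA : rcontraction A.

(** From [2 Z = (I - A) + Z^2] follows [(I - Z)^2 = I - 2 Z + Z^2 = A]. That [Z] is nonexpansive
    gives both [I - Z >= 0] and the norm bound 2. *)
Lemma nonneg_sqrt_exists : exists S, is_nonneg_sqrt A S.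
Proof.
have [Z [lZ sZ nZ eZ]] := sqrt_fixpoint_exists (rcontraction_compl cA).
exists (idfun \- Z).
have lS : linear (idfun \- Z).
  by move=> a x y /=; rewrite lZ scalerBr addrACA opprD.
have rS : rselfadjoint (idfun \- Z) by move=> x y /=; rewrite !rdotE sZ.
have sS : selfadjoint (idfun \- Z) by apply/rselfadjointP.
split => //.
- split => //; exists 2 => x; rewrite !normE -rmorphM/= lecR.
  have := rnormD x (- Z x); rewrite rnormN; have := nZ x; lra.
- move=> x; rewrite linear0l selfadjoint_inner// ler0c /= !rdotE subr_ge0.
  apply: le_trans (rdot_le _ _) _; rewrite -rnorm_sqr expr2.
  by rewrite ler_wpM2r ?rnorm_ge0.
- apply/funext => x /=; rewrite linear_funB//.
  have := eZ x; rewrite /= => /(congr1 (fun u => u - Z (Z x))).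
  rewrite addrK => e; rewrite opprB addrA.
  apply: rdot_ext => z; have := congr1 (fun u => rdot u z) e.
  rewrite /= !rdotE; lra.
Qed.

Lemma op_sqrtP : is_nonneg_sqrt A (op_sqrt A).
Proof. exact: getPex nonneg_sqrt_exists. Qed.

Lemma op_sqrt_rcontraction : rcontraction (op_sqrt A).
Proof. exact: is_nonneg_sqrt_rcontraction op_sqrtP. Qed.

Lemma op_sqrtK x : op_sqrt A (op_sqrt A x) = A x.
Proof. by have [_ _ _ /(congr1 (@^~ x))] := op_sqrtP. Qed.

End SqrtExists.

Lemma rdot0l (R : realType) (H : hilbertType R) (x : H) : rdot 0 x = 0.
Proof. by rewrite /rdot linear0l. Qed.

Lemma rdot_le0_eq0 (R : realType) (H : hilbertType R) (x : H) :
  rdot x x <= 0 -> x = 0.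
Proof.
by rewrite -rnorm_sqr => h; apply: rnorm_eq0; have := rnorm_ge0 x; nra.
Qed.

(** * Ranges of square roots, density and orthogonality *)

Section SqrtRange.
Variables (R : realType) (H : hilbertType R).

(* With [w n = (I - S)^n y] one has [S y - S w n] in the range of [S^2], while
   [|S w n|^2 <= |w n|^2 - |w (n + 1)|^2] is small for some [n]. *)
Lemma range_sub_closure_range_sqr (S : H -> H) (y : H) (e : R) :
  rcontraction S -> 0 < e -> exists z, rnorm (S y - S (S z)) < e.
Proof.
move=> cS e0; have [lS _ _ _] := cS.
pose w n := iter n (idfun \- S) y.
have wS n : exists z, y - w n = S z.
  elim: n => [|n [z wz]]; first by exists 0; rewrite subrr linear_fun0.
  by exists (z + w n); rewrite linear_funD// -wz /= opprB addrA addrAC.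
have w0 n : 0 <= rdot (w n) (w n) by apply: rdot_ge0.
have [|n wn] := small_decrement w0 (e := e ^+ 2); first by rewrite exprn_gt0.
have [z wz] := wS n; exists z; rewrite -wz -linear_funB// opprB addrC subrK.
rewrite -ltr_sqr ?nnegrE ?rnorm_ge0 ?(ltW e0)// rnorm_sqr.
apply: le_lt_trans wn; rewrite /= -/(w n) !rdotE (rdotC (w n) (S (w n))).
have := rcontraction_firm (w n) cS; lra.
Qed.

Lemma op_sqrt_comp_dense_range (G : hilbertType R) (A : H -> H)
    (Q : partial_map G H) :
  rcontraction A -> operator Q -> closure (ran Q) = [set: H] ->
  operator (op_comp (op_sqrt A) Q) /\
  into_with_dense_range (op_comp (op_sqrt A) Q) (closure (range A)).
Proof.
move=> cA [Q0 lQ] Qd; have cS := op_sqrt_rcontraction cA.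
have [lS _ _ _] := cS; have SS := op_sqrtK cA.
split; first by split=> // a u v Du Dv /=; rewrite lQ// lS.
split=> [_ [u Du <-]|x /rnorm_closureP xA]; apply/rnorm_closureP => e e0.
  have [z] := range_sub_closure_range_sqr (Q u) cS e0.
  by rewrite SS => h; exists (A z) => //; exists z.
have e2 : 0 < e / 2 by rewrite divr_gt0.
(* Half of [e] pays for approximating [x] by [A a = S (S a)], the other half for approximating [S a]
   by some [Q u]; applying [S] does not enlarge the latter error. *)
have [_ [a _ <-] xa] := xA _ e2.
have /rnorm_closureP/(_ _ e2)[_ [u Du <-] au] : closure (ran Q) (op_sqrt A a).
  by rewrite Qd.
exists (op_sqrt A (Q u)); first by exists u.
have := rnormD (x - A a) (op_sqrt A (op_sqrt A a - Q u)).
have := rcontraction_nexp (op_sqrt A a - Q u) cS.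
rewrite linear_funB// SS addrA subrK; lra.
Qed.

Lemma range_op_sqrt_sub (A : H -> H) y :
  rcontraction A -> closure (range A) (op_sqrt A y).
Proof.
move=> cA; apply/rnorm_closureP => e e0.
have [z] := range_sub_closure_range_sqr y (op_sqrt_rcontraction cA) e0.
by rewrite op_sqrtK// => h; exists (A z) => //; exists z.
Qed.

(** [A] is nonexpansive, so its kernel is closed, and it contains the range of [B]. *)
Lemma annihilates_closure_range (A B : H -> H) x :
  rcontraction A -> (forall a, A (B a) = 0) -> closure (range B) x -> A x = 0.
Proof.
move=> cA AB /rnorm_closureP xB; have [lA _ _ _] := cA.
apply: rnorm_eq0; apply: ler_addgt0 => e e0; rewrite add0r.
have [_ [a _ <-] xa] := xB _ e0.
have := rcontraction_nexp (x - B a) cA.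
rewrite linear_funB// AB subr0 => h; exact: le_trans h (ltW xa).
Qed.

Lemma orthogonal_closure_eq0 (G : hilbertType R) (M : set (H * G))
    (p : H * G) :
  closure M p -> (forall m, M m -> rdot p.1 m.1 + rdot p.2 m.2 = 0) ->
  p.1 = 0 /\ p.2 = 0.
Proof.
move=> /rnorm_prod_closureP Mp orth.
have : rdot p.1 p.1 + rdot p.2 p.2 <= 0.
  apply: ler_addgt0 => e e0; rewrite add0r.
  (* By orthogonality [|p|^2 + |m|^2 = |p - m|^2]; each of the two components of [p - m] contributes
     less than [d ^+ 2 = e / 2]. *)
  pose d := Num.sqrt (e / 2).
  have d0 : 0 < d by rewrite sqrtr_gt0 divr_gt0.
  have dd : d ^+ 2 = e / 2 by rewrite sqr_sqrtr// divr_ge0// ltW.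
  have [m Mm [m1 m2]] := Mp _ d0.
  have : rnorm (p.1 - m.1) ^+ 2 < e / 2.
    by rewrite -dd ltr_sqr ?nnegrE ?rnorm_ge0 ?ltW.
  have : rnorm (p.2 - m.2) ^+ 2 < e / 2.
    by rewrite -dd ltr_sqr ?nnegrE ?rnorm_ge0 ?ltW.
  have := orth _ Mm; have := rdot_ge0 m.1; have := rdot_ge0 m.2.
  rewrite !rnorm_sqr !rdotE (rdotC m.1 p.1) (rdotC m.2 p.2); lra.
have := rdot_ge0 p.1; have := rdot_ge0 p.2 => h2 h1 h.
by split; apply: rdot_le0_eq0; lra.
Qed.

End SqrtRange.

(** * Minimality and idempotence of K *)

Section Minimality.
Variables (R : realType) (G H : hilbertType R).
Variables (Q : partial_map G H) (K : H -> H).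
Hypotheses (Qd : closure (ran Q) = [set: H]) (cK : rcontraction K).

Local Notation IK := (idfun \- K).
Local Notation S := (op_sqrt IK).
Local Notation T := (op_sqrt K).
Local Notation Q12 := (column (op_comp S Q) (op_comp T Q)).
Local Notation K12 := (closure (range IK) `*` closure (range K)).

Let cIK : rcontraction IK := rcontraction_compl cK.
Let cS : rcontraction S := op_sqrt_rcontraction cIK.
Let cT : rcontraction T := op_sqrt_rcontraction cK.
Let lS : linear S. Proof. by case: cS. Qed.
Let lT : linear T. Proof. by case: cT. Qed.
Let sS : rselfadjoint S. Proof. by case: cS. Qed.
Let sT : rselfadjoint T. Proof. by case: cT. Qed.
Let SS x : S (S x) = x - K x. Proof. exact: op_sqrtK. Qed.
Let TT x : T (T x) = K x. Proof. exact: op_sqrtK. Qed.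

Let KS x : K (S x) = S (K x).
Proof.
have /addrI/oppr_inj-> // : S x - K (S x) = S x - S (K x).
by rewrite -SS (SS x) linear_funB.
Qed.

Let KT x : K (T x) = T (K x).
Proof. by rewrite -!TT. Qed.

Lemma minimal_idempotent : into_with_dense_range Q12 K12 -> K \o K = K.
Proof.
move=> [_ dense]; apply/funext => z /=.
have [||/= e1 _] :=
  @orthogonal_closure_eq0 _ _ _ (ran Q12) (S (K z), - T (z - K z)).
- apply: dense; split; first exact: range_op_sqrt_sub.
  by rewrite /= -linear_funN//; apply: range_op_sqrt_sub.
(* For [q = Q u], moving [S] and [T] across leaves [((I - K) K z - K (I - K) z, q)], which is
   zero. *)
- move=> _ [u _ <-] /=.
  rewrite !rdotE -(sS (S _)) -(sT (T _)) SS TT.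
  by rewrite linear_funB ?subrr//; case: cK.
(* A further [S] turns [S (K z) = 0] into [K z - K (K z) = 0]. *)
have /(congr1 S) := e1.
by rewrite SS linear_fun0// => /subr0_eq.
Qed.

Lemma idempotent_minimal : K \o K = K -> into_with_dense_range Q12 K12.
Proof.
move=> KK; split=> [_ [u _ <-]|[x y] [/= x1 y2]].
  by split; apply: range_op_sqrt_sub.
have [lK _ _ _] := cK.
have KKz z : K (K z) = K z by rewrite -[in RHS]KK.
(* Idempotence means [K (I - K) = (I - K) K = 0]; by continuity [K] vanishes on the first space and
   [I - K] on the second. *)
have Kx : K x = 0.
  apply: annihilates_closure_range x1 => // a /=.
  by rewrite linear_funB// KKz subrr.
have Ky : y - K y = 0.
  apply: (annihilates_closure_range cIK) y2 => a /=.
  by rewrite KKz subrr.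
(* Here [|T S x|^2 = (K S x, S x) = (S K x, S x) = 0], and [S (T y)] is treated in the same way with
   [I - K]. *)
have TSx : T (S x) = 0.
  by apply: rdot_le0_eq0; rewrite sT rdotC TT KS Kx linear_fun0// rdot0l.
have STy : S (T y) = 0.
  apply: rdot_le0_eq0; rewrite sS rdotC SS KT -linear_funB// Ky.
  by rewrite linear_fun0// rdot0l.
apply/rnorm_prod_closureP => e e0.
(* Since [S] and [T] are nonexpansive, one [Q u] within [e] of [S x + T y] controls both components
   at once. *)
have /rnorm_closureP/(_ _ e0)[_ [u Du <-] qu] : closure (ran Q) (S x + T y).
  by rewrite Qd.
exists (S (Q u), T (Q u)); first by exists u.
have Sq := rcontraction_nexp (S x + T y - Q u) cS.
have Tq := rcontraction_nexp (S x + T y - Q u) cT.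
split => /=.
  apply: le_lt_trans qu; move: Sq.
  by rewrite linear_funB// linear_funD// STy SS Kx subr0 addr0.
apply: le_lt_trans qu; move: Tq.
by rewrite linear_funB// linear_funD// TSx TT add0r -(subr0_eq Ky).
Qed.

End Minimality.

Theorem theorem4p3 (R : realType) (HH KK : hilbertType R)
    (h : partial_form R[i] HH) (Q : partial_map HH KK) (K : KK -> KK) :
  sesquilinear_form h -> nonneg_form h ->
  operator Q -> represents h inner Q -> closure (ran Q) = [set: KK] ->
  nonneg_contraction K ->
  let IK : KK -> KK := idfun \- K in
  let K1 : set KK := closure (range IK) in
  let K2 : set KK := closure (range K) in
  let Q1 : partial_map HH KK := op_comp (op_sqrt IK) Q in
  let Q2 : partial_map HH KK := op_comp (op_sqrt K) Q in
  represents h (@osum_inner R KK KK) (column Q1 Q2) ->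
  [/\ operator Q1 /\ into_with_dense_range Q1 K1,
      operator Q2 /\ into_with_dense_range Q2 K2
    & into_with_dense_range (column Q1 Q2) (K1 `*` K2) <->
      orthogonal_projection K].
Proof.
move=> _ _ oQ _ Qd nK IK K1 K2 Q1 Q2 _.
have cK := nonneg_contraction_re nK.
split; [|exact: op_sqrt_comp_dense_range|].
  exact: (op_sqrt_comp_dense_range (rcontraction_compl cK)).
split=> [dense|[_ _ KK2]]; last exact: idempotent_minimal.
have [bK sK _ _] := nK; split=> //; exact: minimal_idempotent dense.
Qed.
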